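(* Let $\mathcal{G}=(G,o,\curlywedge,R_1,\ldots,R_n)$ be a functional Menger $\curlywedge$-algebra of rank $n$ with a zero $\mathbf{0}$, and let $H$ be a nonempty subset of $G$. Then $H$ is a stationary subset of $\mathcal{G}$ if and only if $H$ is $\curlywedge$-quasi-stable and, for all $x,y\in G$ and $i\in\{1,\ldots,n\}$, the following three conditions hold: (1) if $\mathbf{0}\notin H$, then $R_i\mathbf{0}=\mathbf{0}$; (2) if $x[y\ldots y]=y\in H$, then $x\in H$; (3) if $x[y\ldots y]\curlywedge y\neq\mathbf{0}$, then $x\in H$.
   Context: Let $n\geq 1$ be an integer. **Functional algebras.** For a set $A$, an $n$-place function on $A$ is a partial mapping from $A^n$ to $A$ (the empty function is allowed); $\mathcal{F}(A^n,A)$ is the set of all of them, and $\mathrm{pr}_1 f$ is the domain of $f$. Functions are identified with their graphs. Menger's composition $\mathcal{O}:(f,g_1,\ldots,g_n)\mapsto f[g_1\ldots g_n]$ is defined by $f[g_1\ldots g_n](\bar a)=f(g_1(\bar a),\ldots,g_n(\bar a))$ for $\bar a\in A^n$, where both sides are defined or undefined simultaneously. For $i\in\{1,\ldots,n\}$, $\mathcal{R}_if$ is the $n$-place function with domain $\mathrm{pr}_1 f$ given by $\mathcal{R}_if(a_1,\ldots,a_n)=a_i$. A functional Menger $\cap$-algebra of $n$-place functions is an algebra $(\Phi,\mathcal{O},\cap,\mathcal{R}_1,\ldots,\mathcal{R}_n)$ where $\Phi\subseteq\mathcal{F}(A^n,A)$ is closed under $\mathcal{O}$, set-theoretic intersection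 $\cap$ (of graphs) and all $\mathcal{R}_i$. Put $\mathbf{St}(\Phi)=\{f\in\Phi\mid (\exists a\in A)\ f(a,\ldots,a)=a\}$. **Abstract algebras.** A functional Menger $\curlywedge$-algebra of rank $n$ is an algebra $\mathcal{G}=(G,o,\curlywedge,R_1,\ldots,R_n)$ with $G$ nonempty, of type $(n+1,2,1,\ldots,1)$, where the $(n+1)$-ary operation is written $o:(x_0,x_1,\ldots,x_n)\mapsto x_0[x_1\ldots x_n]$, $(G,\curlywedge)$ is a semilattice, and the following axioms hold for all elements of $G$ and all $i,k\in\{1,\ldots,n\}$. Here $x[\bar u|_i z]$ means $x[u_1\ldots u_{i-1}\,z\,u_{i+1}\ldots u_n]$, and $R_ix[y_1\ldots y_n]$ means $R_i(x[y_1\ldots y_n])$. Bracket composition binds more tightly than $\curlywedge$. - $A_1$: $x[y_1\ldots y_n][z_1\ldots z_n]=x[y_1[z_1\ldots z_n]\ldots y_n[z_1\ldots z_n]]$; - $A_2$: $x[R_1x\ldots R_nx]=x$; - $A_3$: $x[\bar u|_i z][R_1y\ldots R_ny]=x[\bar u|_i\, z[R_1y\ldots R_ny]]$; - $A_4$: $R_ix[R_1y\ldots R_ny]=(R_ix)[R_1y\ldots R_ny]$; - $A_5$: $x[R_1y\ldots R_ny][R_1z\ldots R_nz]=x[R_1z\ldots R_nz][R_1y\ldots R_ny]$; - $A_6$: $R_ix[y_1\ldots y_n]=R_i((R_kx)[y_1\ldots y_n])$; - $A_7$: $(R_ix)[y_1\ldots y_n]=y_i[R_1(x[y_1\ldots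 y_n])\ldots R_n(x[y_1\ldots y_n])]$; - $A_8$: $x\curlywedge y[R_1z\ldots R_nz]=(x\curlywedge y)[R_1z\ldots R_nz]$; - $A_9$: $x\curlywedge y=x[R_1(x\curlywedge y)\ldots R_n(x\curlywedge y)]$; - $A_{10}$: $(x\curlywedge y)[z_1\ldots z_n]=x[z_1\ldots z_n]\curlywedge y[z_1\ldots z_n]$. A zero of $\mathcal{G}$ is a zero of $(G,o)$: an element $\mathbf{0}\in G$ such that $\mathbf{0}[x_1\ldots x_n]=\mathbf{0}$ for all $x_1,\ldots,x_n\in G$, and $x[y_1\ldots y_n]=\mathbf{0}$ whenever some $y_i=\mathbf{0}$. **Representations and stationary subsets.** A representation of $\mathcal{G}$ by $n$-place functions is a mapping $P:G\to\mathcal{F}(A^n,A)$, for some set $A$, that is a homomorphism into a functional Menger $\cap$-algebra, i.e. $P(x[y_1\ldots y_n])=P(x)[P(y_1)\ldots P(y_n)]$, $P(x\curlywedge y)=P(x)\cap P(y)$ and $P(R_ix)=\mathcal{R}_iP(x)$. It is faithful if it is an isomorphism onto its image, i.e. injective. A nonempty subset $H\subseteq G$ is a stationary subset of $\mathcal{G}$ if there is a faithful representation $P$ of $\mathcal{G}$ by $n$-place functions such that for every $g\in G$: $g\in H\iff P(g)\in\mathbf{St}(P(G))$, where $P(G)=\{P(g)\mid g\in G\}$. A nonempty subset $H\subseteq G$ is $\curlywedge$-quasi-stable if for all $x\in G$: $x\in H$ implies $x[x\ldots x]\curlywedge x\in H$. *)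

(* Defs.v *)
From mathcomp Require Import all_boot.
From mathcomp Require Import boolp classical_sets.

Set Implicit Arguments.
Unset Strict Implicit.
Unset Printing Implicit Defensive.

Local Open Scope classical_set_scope.

(* An n-tuple over T is a function 'I_n -> T, the indices 1, ..., n being
   shifted to 0, ..., n-1; the diagonal tuple (a, ..., a) is fun=> a. *)

(* An n-place partial function is its graph, a set of pairs (arguments, value). *)
Record pfunc (n : nat) (A : Type) := PFunc {
  graph : set (('I_n -> A) * A);
  graph_functional : forall a b c, graph (a, b) -> graph (a, c) -> b = c }.

Definition pr1 n A (f : pfunc n A) : set ('I_n -> A) :=
  [set a | exists b, graph f (a, b)].

Definition comp_graph n A (f : pfunc n A) (g : 'I_n -> pfunc n A) :
    set (('I_n -> A) * A) :=
  [set p | exists b : 'I_n -> A,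
     (forall i, graph (g i) (p.1, b i)) /\ graph f (b, p.2)].

Lemma comp_graph_functional n A (f : pfunc n A) (g : 'I_n -> pfunc n A) a b c :
  comp_graph f g (a, b) -> comp_graph f g (a, c) -> b = c.
Proof.
move=> [u [/= gu fu]] [v [/= gv fv]].
have uv : u = v by apply/funext => i; exact: graph_functional (gu i) (gv i).
by rewrite -uv in fv; exact: graph_functional fu fv.
Qed.

Definition pfunc_comp n A (f : pfunc n A) (g : 'I_n -> pfunc n A) : pfunc n A :=
  PFunc (@comp_graph_functional n A f g).

Lemma cap_graph_functional n A (f g : pfunc n A) a b c :
  (graph f `&` graph g) (a, b) -> (graph f `&` graph g) (a, c) -> b = c.
Proof. by move=> [fb _] [fc _]; exact: graph_functional fb fc. Qed.

Definition pfunc_cap n A (f g : pfunc n A) : pfunc n A :=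
  PFunc (@cap_graph_functional n A f g).

Definition proj_graph n A (i : 'I_n) (f : pfunc n A) : set (('I_n -> A) * A) :=
  [set p | pr1 f p.1 /\ p.2 = p.1 i].

Lemma proj_graph_functional n A (i : 'I_n) (f : pfunc n A) a b c :
  proj_graph i f (a, b) -> proj_graph i f (a, c) -> b = c.
Proof. by move=> [_ /= ->] [_ /= ->]. Qed.

Definition pfunc_proj n A (i : 'I_n) (f : pfunc n A) : pfunc n A :=
  PFunc (@proj_graph_functional n A i f).

Definition St n A (Phi : set (pfunc n A)) : set (pfunc n A) :=
  [set f | Phi f /\ exists a : A, graph f (fun=> a, a)].

Reserved Notation "x .[ u ]" (at level 1, left associativity, format "x .[ u ]").

(* R^~ y is the tuple (R_1 y, ..., R_n y), and [eta u with i |-> z] is the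
   tuple u with its i-th entry replaced by z. *)
Record menger_axioms (n : nat) (G : Type) (o : G -> ('I_n -> G) -> G)
    (m : G -> G -> G) (R : 'I_n -> G -> G) : Prop := MengerAxioms {
  menger_nonempty : inhabited G;
  menger_meetA : associative m;
  menger_meetC : commutative m;
  menger_meetI : idempotent_op m;
  menger_A1 : forall x y z, o (o x y) z = o x (fun i => o (y i) z);
  menger_A2 : forall x, o x (R^~ x) = x;
  menger_A3 : forall x u i z y,
    o (o x [eta u with i |-> z]) (R^~ y) = o x [eta u with i |-> o z (R^~ y)];
  menger_A4 : forall i x y, R i (o x (R^~ y)) = o (R i x) (R^~ y);
  menger_A5 : forall x y z,
    o (o x (R^~ y)) (R^~ z) = o (o x (R^~ z)) (R^~ y);
  menger_A6 : forall i k x y, R i (o x y) = R i (o (R k x) y);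
  menger_A7 : forall i x y, o (R i x) y = o (y i) (R^~ (o x y));
  menger_A8 : forall x y z, m x (o y (R^~ z)) = o (m x y) (R^~ z);
  menger_A9 : forall x y, m x y = o x (R^~ (m x y));
  menger_A10 : forall x y z, o (m x y) z = m (o x z) (o y z) }.

Record functionalMengerAlgebra (n : nat) := FunctionalMengerAlgebra {
  carrier :> Type;
  mcomp : carrier -> ('I_n -> carrier) -> carrier;
  mmeet : carrier -> carrier -> carrier;
  mR : 'I_n -> carrier -> carrier;
  mengerP : menger_axioms mcomp mmeet mR }.

Notation "x .[ u ]" := (mcomp x u).
Notation "x \curlywedge y" := (mmeet x y) (at level 50, left associativity).

Definition is_zero n (G : functionalMengerAlgebra n) (z : G) : Prop :=
  (forall x : 'I_n -> G, z.[x] = z) /\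
  (forall (x : G) (y : 'I_n -> G), (exists i, y i = z) -> x.[y] = z).

(* The target algebra may be taken to be the algebra of all n-place functions
   on A, or the image of P, which these equations make closed. *)
Definition is_representation n (G : functionalMengerAlgebra n) (A : Type)
    (P : G -> pfunc n A) : Prop :=
  [/\ forall (x : G) (y : 'I_n -> G), P x.[y] = pfunc_comp (P x) (P \o y),
      forall x y : G, P (x \curlywedge y) = pfunc_cap (P x) (P y)
    & forall i (x : G), P (mR i x) = pfunc_proj i (P x)].

Definition is_faithful_representation n (G : functionalMengerAlgebra n)
    (A : Type) (P : G -> pfunc n A) : Prop :=
  is_representation P /\ injective P.

Definition stationary n (G : functionalMengerAlgebra n) (H : set G) : Prop :=
  H !=set0 /\
  exists (A : Type) (P : G -> pfunc n A), is_faithful_representation P /\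
    forall g : G, H g <-> St (range P) (P g).

Definition quasi_stable n (G : functionalMengerAlgebra n) (H : set G) : Prop :=
  H !=set0 /\ forall x : G, H x -> H (x.[fun=> x] \curlywedge x).

(* Main.v *)
Require Import Defs.
From mathcomp Require Import all_boot.
From mathcomp Require Import boolp classical_sets.

(** Call two elements of [G] domain-equivalent if all their [R_i] agree.  Let
    [G] act on itself by [x : (y_1, ..., y_n) |-> x[y_1 ... y_n]], defined only
    when the [y_i] and the value are all domain-equivalent, a Menger analogue of
    the Vagner-Preston representation.  This is faithful, because [x] sends
    [(R_1 x, ..., R_n x)] to [x], and it stays so when the value [0] is
    discarded, provided [R_i 0 = 0].  A fixed point of [x] is some [y] with
    [x[y ... y] = y]; for [x] in [H] the element [x[x ... x] /\ x] of [H] is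
    one.  We discard the value [0] exactly when [0] is not in [H]. *)

Set Implicit Arguments.
Unset Strict Implicit.

Local Open Scope classical_set_scope.

Lemma pfunc_ext n A (f g : pfunc n A) :
  (forall a b, graph f (a, b) <-> graph g (a, b)) -> f = g.
Proof.
case: f g => [F Ff] [E Eg] /= FE.
have {}FE : F = E by apply/funext => -[a b]; exact/propext.
by move: Ff Eg; rewrite FE => Ff Eg; congr PFunc; exact: Prop_irrelevance.
Qed.

Section DomainAction.
Variables (n : nat) (G : functionalMengerAlgebra n).
Implicit Types (x y z a b : G) (u : 'I_n -> G).

Notation dom x := (fun i => mR i x).

Lemma comp_dom x : x.[dom x] = x.
Proof. exact: (menger_A2 (mengerP G)). Qed.

Lemma mR_mR i k x : mR i (mR k x) = mR i x.
Proof.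
have := menger_A6 (mengerP G) i k x (dom x).
by rewrite -(menger_A4 (mengerP G)) !comp_dom.
Qed.

Lemma dom_mR k x : dom (mR k x) = dom x.
Proof. by apply/funext => i; exact: mR_mR. Qed.

Lemma dom_mR_comp k x u : dom ((mR k x).[u]) = dom (x.[u]).
Proof. by apply/funext => i; rewrite -(menger_A6 (mengerP G)). Qed.

Lemma comp_restr x u i : x.[u].[dom (u i)] = x.[u].
Proof.
have uE : [eta u with i |-> u i] = u :> ('I_n -> G).
  by apply/funext => j /=; case: eqP => // ->.
by have := menger_A3 (mengerP G) x u i (u i) (u i); rewrite comp_dom uE.
Qed.

Lemma restr_eq_dom x u b :
  (forall i, dom (u i) = dom b) -> x.[u].[dom b] = x.[u].
Proof.
move=> ub; have [[i _]|n0] := pselect (exists i : 'I_n, True).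
  by rewrite -(ub i) comp_restr.
(* For [n = 0] all tuples coincide. *)
have -> : dom b = dom x.[u] by apply/funext => i; case: n0; exists i.
exact: comp_dom.
Qed.

(** Each hypothesis is an inclusion of domains. Under the first, [menger_A7] turns [(R_i a)[dom b]]
    into [(R_i b)[dom a]]. *)
Lemma dom_anti a b : a.[dom b] = a -> b.[dom a] = b -> dom a = dom b.
Proof.
move=> ab ba; apply/funext => i.
rewrite -[in LHS]ab (menger_A4 (mengerP G)) (menger_A7 (mengerP G)) ab.
by rewrite -(menger_A4 (mengerP G)) ba.
Qed.

(** Antisymmetry of the restriction order: [b.[dom a] = a] makes [a] a restriction of [b]. *)
Lemma restr_anti a b : b.[dom a] = a -> a.[dom b] = b -> a = b.
Proof.
move=> ba ab; rewrite -ab -{2}ba (menger_A5 (mengerP G)) comp_dom.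
by rewrite ba.
Qed.

Lemma meet_restr a b : a \curlywedge b = a.[dom (a \curlywedge b)].
Proof. exact: (menger_A9 (mengerP G)). Qed.

Lemma meetC a b : a \curlywedge b = b \curlywedge a.
Proof. exact: (menger_meetC (mengerP G)). Qed.

Lemma meetI a : a \curlywedge a = a.
Proof. exact: (menger_meetI (mengerP G)). Qed.

(** As [h] is [x] restricted to [dom h], [menger_A1] turns [x.[fun=> h]] into [x.[fun=> x].[dom h]],
    which is [h] by [menger_A9]. *)
Lemma comp_meet_fixed x (h := x.[fun=> x] \curlywedge x) : x.[fun=> h] = h.
Proof.
have hx : x.[dom h] = h by rewrite {2}/h meetC meet_restr meetC.
by rewrite {2}/h meet_restr (menger_A1 (mengerP G)) hx.
Qed.

(** [D] holds the values that are kept. Closure under domain equivalence keeps the intermediate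
    values of a composition in [D]. *)
Variable D : set G.
Hypothesis D_dom : forall a b, dom a = dom b -> D a -> D b.

Definition action_graph x : set (('I_n -> G) * G) :=
  [set p | [/\ p.2 = x.[p.1], D p.2 & forall i, dom (p.1 i) = dom p.2]].

Lemma action_graph_functional x u a b :
  action_graph x (u, a) -> action_graph x (u, b) -> a = b.
Proof. by move=> [/= -> _ _] [/= -> _ _]. Qed.

Definition action x : pfunc n G := PFunc (@action_graph_functional x).

Lemma action_comp x (y : 'I_n -> G) :
  action x.[y] = pfunc_comp (action x) (action \o y).
Proof.
apply: pfunc_ext => u b; split=> [[/= bE Db ub]|[c [/= uc [/= bE Db cb]]]].
  pose c i := (y i).[u].
  have bc : b = x.[c] by rewrite bE (menger_A1 (mengerP G)).
  (* One inclusion holds because the entries of [u] have the domain of [b], the other because [b] is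
     a composite through [c i]. *)
  have cb i : dom (c i) = dom b.
    apply: dom_anti; first exact: restr_eq_dom.
    by rewrite bc comp_restr.
  exists c; split=> // i; split=> //=; first exact: D_dom (esym (cb i)) Db.
  by move=> j; rewrite ub cb.
have cE : c = fun i => (y i).[u].
  by apply/funext => i; case: (uc i).
split=> //=; first by rewrite bE cE (menger_A1 (mengerP G)).
by move=> i; case: (uc i) => _ _ /(_ i) /= ->; exact: cb.
Qed.

(** The value [b] of the meet at [u] is [x.[u]] restricted to [dom b]; this restriction changes
    nothing, since the entries of [u] have the domain of [b]. The same holds for [y]. *)
Lemma action_meet x y :
  action (x \curlywedge y) = pfunc_cap (action x) (action y).
Proof.
apply: pfunc_ext => u b; split=> [[/= bE Db ub]|[[/= bx Db ub] [/= b_y _ _]]].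
  rewrite (menger_A10 (mengerP G)) in bE.
  split; split=> //=.
    by rewrite {1}bE meet_restr -bE restr_eq_dom.
  by rewrite {1}bE meetC meet_restr meetC -bE restr_eq_dom.
by split=> //=; rewrite (menger_A10 (mengerP G)) -bx -b_y meetI.
Qed.

Lemma action_mR i x : action (mR i x) = pfunc_proj i (action x).
Proof.
apply: pfunc_ext => u b; split=> [[/= bE Db ub]|[[/= c [/= cE Dc uc]] /= ->]].
  have cb : dom x.[u] = dom b by rewrite bE dom_mR_comp.
  split=> /=; last first.
    by rewrite bE (menger_A7 (mengerP G)) cb -(ub i) comp_dom.
  exists x.[u]; split=> //=; first exact: D_dom (esym cb) Db.
  by move=> j; rewrite ub cb.
split=> /=; last by move=> j; rewrite !uc.
  by rewrite (menger_A7 (mengerP G)) -cE -(uc i) comp_dom.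
exact: D_dom (esym (uc i)) Dc.
Qed.

Lemma action_representation : is_representation action.
Proof. by split; [exact: action_comp|exact: action_meet|exact: action_mR]. Qed.

Lemma action_restr x y : action x = action y -> D x -> y.[dom x] = x.
Proof.
move=> xy Dx.
have : graph (action x) (dom x, x).
  by split=> //= [|i]; rewrite ?comp_dom ?dom_mR.
by rewrite xy => -[].
Qed.

(** The hypothesis puts elements outside [D] below all others in the restriction order, where the
    action cannot detect it. *)
Lemma action_injective :
  (forall x y, ~ D x -> y.[dom x] = x) -> injective action.
Proof.
move=> DN x y xy; apply: restr_anti.
  by have [Dx|/DN//] := pselect (D x); exact: action_restr.
by have [Dy|/DN//] := pselect (D y); apply: action_restr.
Qed.

Lemma action_fixed x :
  (exists y, graph (action x) (fun=> y, y)) <->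
  (exists2 y, x.[fun=> y] = y & D y).
Proof.
split=> [[y [/= xy Dy _]]|[y xy Dy]]; first by exists y.
by exists y.
Qed.

End DomainAction.

Section Necessity.
Variables (n : nat) (n_gt0 : 0 < n) (G : functionalMengerAlgebra n).
Variables (zero : G) (zeroP : is_zero zero) (A : Type) (P : G -> pfunc n A).
Hypothesis P_faithful : is_faithful_representation P.

Let P_comp x y : P x.[y] = pfunc_comp (P x) (P \o y).
Proof. by case: P_faithful => -[]. Qed.

Let P_meet x y : P (x \curlywedge y) = pfunc_cap (P x) (P y).
Proof. by case: P_faithful => -[]. Qed.

Let P_inj : injective P. Proof. by case: P_faithful. Qed.

(** At [u] the function [P y] takes the value [b], so the tuple passed to [P x] is constantly
    [b]. *)
Lemma graph_comp_meet x y u b :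
  graph (P (x.[fun=> y] \curlywedge y)) (u, b) -> graph (P x) (fun=> b, b).
Proof.
rewrite P_meet P_comp => -[[c [/= yc xc]] yb].
by have <- : c = fun=> b by apply/funext => i; exact: graph_functional (yc i) yb.
Qed.

Lemma graph_zero_nonempty x u b :
  graph (P zero) (u, b) -> exists v c, graph (P x) (v, c).
Proof.
have <- : x.[fun=> zero] = zero by apply: zeroP.2; exists (Ordinal n_gt0).
by rewrite P_comp => -[c [_ xc]]; exists c, b.
Qed.

(** Since [zero] is [x.[fun=> zero]], an empty [P x] forces an empty [P zero]; then injectivity
    applies. *)
Lemma empty_graph_zero x : (forall u b, ~ graph (P x) (u, b)) -> x = zero.
Proof.
move=> x0; apply: P_inj; apply: pfunc_ext => u b; split=> [/x0//|].
by move=> /(graph_zero_nonempty x)[v [c /x0]].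
Qed.

(** [zero] equals [zero.[fun=> zero] \curlywedge zero], so all values of [P zero] are fixed
    points. *)
Lemma fixed_zero u b : graph (P zero) (u, b) -> graph (P zero) (fun=> b, b).
Proof.
move=> zub; apply: (@graph_comp_meet zero zero u).
by rewrite zeroP.1 (menger_meetI (mengerP G)).
Qed.

Lemma fixed_comp_meet x a : graph (P x) (fun=> a, a) ->
  graph (P (x.[fun=> x] \curlywedge x)) (fun=> a, a).
Proof. by move=> xa; rewrite P_meet P_comp; split=> //=; exists (fun=> a). Qed.

Lemma fixed_comp x y a : x.[fun=> y] = y -> graph (P y) (fun=> a, a) ->
  graph (P x) (fun=> a, a).
Proof.
move=> xy ya; apply: (@graph_comp_meet x y (fun=> a)).
by rewrite xy (menger_meetI (mengerP G)).
Qed.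

Lemma mR_zero i : ~ (exists a, graph (P zero) (fun=> a, a)) ->
  mR i zero = zero.
Proof.
move=> z0; apply: empty_graph_zero => u b.
case: P_faithful => -[_ _ ->] _ [[c zc] _].
by apply: z0; exists c; exact: fixed_zero zc.
Qed.

End Necessity.

Theorem theorem1 (n : nat) (n_ge1 : 1 <= n) (G : functionalMengerAlgebra n)
    (zero : G) (zeroP : is_zero zero) (H : set G) (H_neq0 : H !=set0) :
  stationary H <->
  (quasi_stable H /\
   forall (x y : G) (i : 'I_n),
     [/\ ~ H zero -> mR i zero = zero,
         x.[fun=> y] = y /\ H y -> H x
       & x.[fun=> y] \curlywedge y <> zero -> H x]).
Proof.
split=> [[_ [A [P [Pf HSt]]]]|[[_ Hqs] H3]].
  have HP x : H x <-> exists a, graph (P x) (fun=> a, a).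
    by rewrite HSt; split=> [[]//|xa]; split=> //; exists x.
  split.
    split=> // x /HP[a xa]; apply/HP; exists a; exact: fixed_comp_meet.
  move=> x y i; split.
  - by move=> Hz; apply: (mR_zero n_ge1 zeroP Pf) => /HP.
  - by move=> [xy /HP[a ya]]; apply/HP; exists a; apply: (fixed_comp Pf xy).
  - move=> xy0; apply: contrapT => Hx; apply: xy0.
    apply: (empty_graph_zero n_ge1 zeroP Pf) => u b /(graph_comp_meet Pf) xb.
    by apply/Hx/HP; exists b.
split=> //; pose i0 := Ordinal n_ge1.
pose D : set G := [set b | b = zero -> H zero].
have D_dom a b : (fun i => mR i a) = (fun i => mR i b) -> D a -> D b.
  move=> ab Da b0; apply: contrapT => Hz; apply: (Hz); apply: Da.
  have [Rz _ _] := H3 zero zero i0.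
  (* With [R_i 0 = 0], only [zero] is domain-equivalent to [zero]. *)
  rewrite -[LHS](comp_dom a) ab b0; apply: zeroP.2.
  by exists i0; exact: Rz.
exists G, (action D); split.
  split; first exact: action_representation.
  apply: action_injective => x y /not_implyP[-> Hz].
  have [Rz _ _] := H3 zero zero i0.
  by apply: zeroP.2; exists i0; exact: Rz.
move=> x; split=> [Hx|[_ /action_fixed[y xy Dy]]].
  split; first by exists x.
  apply/action_fixed; exists (x.[fun=> x] \curlywedge x).
    exact: comp_meet_fixed.
  by move=> h0; rewrite -h0; exact: Hqs.
have [_ H2x H3x] := H3 x y i0.
(* A zero fixed point lies in [D] only if [zero] is in [H], so condition (2) applies; a nonzero one
   falls under (3). *)
have [y0|y0] := pselect (y = zero).
  by apply: H2x; split=> //; rewrite y0; exact: Dy.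
by apply: H3x; rewrite xy meetI.
Qed.
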